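(* Let $r>0$. Given any initial value $m(0)=h=(h_0,h_1,h_2,h_3)\in\mathrm{Sp}(1)$ (unit quaternions), the ODE $$\frac{dm}{dt}=\frac{2(r^3+2)(r^3-1)m_2}{r^2}\begin{pmatrix}0&0&m_0&0\\0&0&m_1&0\\-m_0&-m_1&0&-m_3\\0&0&m_3&0\end{pmatrix}m,\qquad m=(m_0,m_1,m_2,m_3),$$ admits the following unique solution, defined for all $t\in\mathbb{R}$: $$m_2(t)=\frac{h_2}{\sqrt{(1-h_2^2)\,e^{\frac{4(r^3+2)(r^3-1)t}{r^2}}+h_2^2}},\qquad m_k(t)=\frac{h_k\,e^{\frac{2(r^3+2)(r^3-1)t}{r^2}}}{\sqrt{(1-h_2^2)\,e^{\frac{4(r^3+2)(r^3-1)t}{r^2}}+h_2^2}},\quad k=0,1,3.$$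
   Context: $\mathrm{Sp}(1)$ is identified with the unit sphere $\{(h_0,h_1,h_2,h_3)\in\mathbb{R}^4: h_0^2+h_1^2+h_2^2+h_3^2=1\}$ via $h=h_0+h_1i+h_2j+h_3k$. *)

(* Defs.v *)
From HB Require Import structures.
From mathcomp Require Import all_boot all_order all_algebra.
From mathcomp Require Import all_classical all_reals all_analysis.
Set Implicit Arguments.
Unset Strict Implicit.
Unset Printing Implicit Defensive.
Import Order.TTheory GRing.Theory Num.Theory.
Import numFieldNormedType.Exports.
Local Open Scope classical_set_scope.
Local Open Scope ring_scope.

(** The unit quaternion h0 + h1 i + h2 j + h3 k is the column vector
    (h0, h1, h2, h3), whose k-th coordinate is [h k 0]. *)
Definition Sp1 (R : realType) : set 'cV[R]_4 :=
  [set h | h 0 0 ^+ 2 + h 1 0 ^+ 2 + h 2 0 ^+ 2 + h 3 0 ^+ 2 = 1].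

Definition flow_matrix (R : realType) (m : 'cV[R]_4) : 'M[R]_4 :=
  \matrix_(i, j)
    (nth [::] [:: [:: 0;          0;          m 0 0; 0];
                  [:: 0;          0;          m 1 0; 0];
                  [:: - m 0 0;    - m 1 0;    0;     - m 3 0];
                  [:: 0;          0;          m 3 0; 0]] i)`_j.

Definition flow_field (R : realType) (r : R) (m : 'cV[R]_4) : 'cV[R]_4 :=
  (2 * (r ^+ 3 + 2) * (r ^+ 3 - 1) * m 2 0 / r ^+ 2) *: (flow_matrix m *m m).

(** Used for open [I] only: [is_derive] is a two-sided derivative, so it does
    not depend on the values of [m] outside of [I]. *)
Definition flow_solution_on (R : realType) (r : R) (I : set R) (h : 'cV[R]_4)
    (m : R -> 'cV[R]_4) : Prop :=
  [/\ I 0, m 0 = h & forall t : R, I t -> is_derive t 1 m (flow_field r (m t))].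

Definition explicit_flow (R : realType) (r : R) (h : 'cV[R]_4) (t : R) :
    'cV[R]_4 :=
  let d := Num.sqrt
    ((1 - h 2 0 ^+ 2) * expR (4 * (r ^+ 3 + 2) * (r ^+ 3 - 1) * t / r ^+ 2)
     + h 2 0 ^+ 2) in
  \col_k (if k == 2 then h 2 0 / d
          else h k 0 * expR (2 * (r ^+ 3 + 2) * (r ^+ 3 - 1) * t / r ^+ 2) / d).

(* Main.v *)
(** On the sphere the field reads m_2' = - a m_2 (1 - m_2^2) and
    m_k' = a m_2^2 m_k for k = 0, 1, 3, where a = [flow_rate r]. The explicit
    curve is the normalisation of (E h_0, E h_1, h_2, E h_3), E = exp (a t).
    For uniqueness, |m|^2 is conserved, so the m_2 components of two solutions
    differ by a function satisfying |f'| <= 2 |a| |f|, which vanishes by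
    Gronwall; once m_2 is known the other components satisfy a linear equation
    with bounded coefficient, and Gronwall applies again. *)
Require Import Defs.
From HB Require Import structures.
From mathcomp Require Import all_boot all_order all_algebra.
From mathcomp Require Import all_classical all_reals all_analysis.
From mathcomp Require Import ring lra.
Import Order.TTheory GRing.Theory Num.Theory.
Import numFieldNormedType.Exports.
Local Open Scope classical_set_scope.
Local Open Scope ring_scope.

Lemma is_derive_colP {R : realFieldType} {n : nat} (m : R -> 'cV[R]_n)
    (t : R) (v : 'cV[R]_n) :
  is_derive t 1 m v <-> forall k, is_derive t 1 (fun x => m x k 0) (v k 0).
Proof.
split=> [[dm <-] k|dm].
  have dmk := (derivable_mxP m t 1).1 dm k 0.
  by apply: DeriveDef => //; rewrite derive_mx// mxE.
have m_t : derivable m t 1.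
  by apply/derivable_mxP => k j; rewrite (ord1 j); case: (dm k).
apply: DeriveDef => //; rewrite derive_mx//.
by apply/colP => k; rewrite mxE; case: (dm k).
Qed.

Lemma is_derive_expRM {R : realType} (a t : R) :
  is_derive t 1 (fun x => expR (a * x)) (a * expR (a * t)).
Proof.
have ? : is_derive t 1 (fun x : R => a * x) a.
  by apply: is_derive_eq; rewrite /GRing.scale/= mulr1.
by rewrite mulrC; exact: is_derive1_comp.
Qed.

Section gronwall.
Context {R : realType}.
Implicit Types (I : set R) (K : R).

(* [f^2 exp (- 2 K t)] is nonincreasing. *)
Lemma gronwall_eq0_ge0 (f f' : R -> R) I K t : is_interval I -> I 0 -> f 0 = 0 ->
  (forall x, I x -> is_derive x 1 f (f' x)) ->
  (forall x, I x -> `|f' x| <= K * `|f x|) ->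
  I t -> 0 <= t -> f t = 0.
Proof.
move=> itvI I0 f0 df bf It t0.
pose V x := f x ^+ 2 * expR (- (2 * K) * x).
pose V' x := 2 * (f x * f' x - K * f x ^+ 2) * expR (- (2 * K) * x).
have dV x : I x -> is_derive x 1 V (V' x).
  move=> Ix; have ? := df _ Ix; have ? := is_derive_expRM (- (2 * K)) x.
  apply: is_derive_eq; rewrite /V' /GRing.scale/=; ring.
have subI x : x \in `[0, t] -> I x.
  by rewrite in_itv/= => x0t; apply: (itvI 0 t).
have [||c c0t Vt] := @MVT_segment R V V' 0 t t0.
- by move=> x /subset_itv_oo_cc/subI/dV.
- apply: derivable_within_continuous => x /subI /dV.
  by case.
have Ic := subI _ c0t.
(* Here [f c * f' c] is at most [|f c| * |f' c|], hence at most [K * f c ^+ 2], whatever the sign of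
   [K]. *)
have V'le0 : V' c <= 0.
  rewrite /V' pmulr_lle0 ?expR_gt0// pmulr_rle0// subr_le0.
  rewrite (le_trans (ler_norm _))// normrM.
  rewrite (le_trans (ler_wpM2l _ (bf _ Ic)))//.
  by rewrite mulrCA -normrM ger0_norm -expr2 ?sqr_ge0.
have : V t <= 0.
  have -> : V t = V t - V 0 by rewrite /V f0 expr0n mul0r subr0.
  by rewrite Vt subr0 mulr_le0_ge0.
rewrite /V pmulr_lle0 ?expR_gt0// => ft.
by apply/eqP; rewrite -sqrf_eq0 eq_le ft sqr_ge0.
Qed.

(** Negative times reduce to positive ones by the reversal [x -> - x], which reflects [I], turns the
    derivative into [- f' (- x)] and preserves the bound. *)
Lemma gronwall_eq0 (f f' : R -> R) I K t : is_interval I -> I 0 -> f 0 = 0 ->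
  (forall x, I x -> is_derive x 1 f (f' x)) ->
  (forall x, I x -> `|f' x| <= K * `|f x|) ->
  I t -> f t = 0.
Proof.
move=> itvI I0 f0 df bf It; have [t0|/ltW t0] := leP 0 t.
  exact: (gronwall_eq0_ge0 f f' I K).
have <- : (f \o -%R) (- t) = f t by rewrite /= opprK.
apply: (gronwall_eq0_ge0 _ (fun x => - f' (- x)) [set x | I (- x)] K) => //=.
- move=> x y Ix Iy z /andP[xz zy]; apply: (itvI _ _ Iy Ix).
  by rewrite !lerN2 xz zy.
- by rewrite oppr0.
- by rewrite oppr0.
- by move=> x /df dfx; rewrite -mulrN1; apply: is_derive1_comp.
- by move=> x /bf; rewrite normrN.
- by rewrite opprK.
- by rewrite oppr_ge0.
Qed.

End gronwall.

Section flow.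
Context {R : realType}.
Implicit Types (r : R) (h : 'cV[R]_4) (m : R -> 'cV[R]_4) (I : set R).

Definition flow_rate r : R := 2 * (r ^+ 3 + 2) * (r ^+ 3 - 1) / r ^+ 2.

(** The sum of squares is not yet replaced by [1 - h 2 0 ^+ 2]: this formula serves to prove that
    the sphere is invariant. *)
Lemma flow_fieldE r h k : flow_field r h k 0 =
  if k == 2 then
    - flow_rate r * h 2 0 * (h 0 0 ^+ 2 + h 1 0 ^+ 2 + h 3 0 ^+ 2)
  else flow_rate r * h 2 0 ^+ 2 * h k 0.
Proof.
rewrite /flow_field /flow_rate !mxE !big_ord_recl big_ord0 !mxE/=.
have -> : lift ord0 ord0 = 1 :> 'I_4 by exact/val_inj.
have -> : lift ord0 (lift ord0 ord0) = 2 :> 'I_4 by exact/val_inj.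
have -> : lift ord0 (lift ord0 (lift ord0 ord0)) = 3 :> 'I_4 by exact/val_inj.
case: k => -[|[|[|[|//]]]] kP /=.
- rewrite (_ : Ordinal kP = 0); last exact/val_inj.
  ring.
- rewrite (_ : Ordinal kP = 1); last exact/val_inj.
  ring.
- ring.
- rewrite (_ : Ordinal kP = 3); last exact/val_inj.
  ring.
Qed.

(** The matrix is skew-symmetric, so the field is orthogonal to [m] and |m|^2 is constant. Constancy
    is the case [K = 0] of Gronwall, applied to |m|^2 - 1. *)
Lemma flow_solution_Sp1 r I h m : is_interval I -> Sp1 h ->
  flow_solution_on r I h m -> forall t, I t -> Sp1 (m t).
Proof.
move=> itvI hS [I0 m0 dm] t It.
pose N x := m x 0 0 ^+ 2 + m x 1 0 ^+ 2 + m x 2 0 ^+ 2 + m x 3 0 ^+ 2 - 1.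
suff /eqP : N t = 0 by rewrite subr_eq0 => /eqP.
apply: (gronwall_eq0 N (cst 0) I 0) => //.
- by rewrite /N m0 hS subrr.
- move=> x Ix; have dmx := (is_derive_colP _ _ _).1 (dm x Ix).
  have d0 := dmx 0; have d1 := dmx 1; have d2 := dmx 2; have d3 := dmx 3.
  rewrite /N; apply: is_derive_eq.
  by rewrite !flow_fieldE /GRing.scale/=; ring.
- by move=> x _; rewrite normr0 mul0r.
Qed.

Lemma flow_solution_unique r I h m p : is_interval I -> Sp1 h ->
  flow_solution_on r I h m -> flow_solution_on r I h p ->
  forall t, I t -> m t = p t.
Proof.
move=> itvI hS solm solp.
have mS := flow_solution_Sp1 _ _ _ _ itvI hS solm.
have pS := flow_solution_Sp1 _ _ _ _ itvI hS solp.
case: solm solp => I0 m0 dm [_ p0 dp].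
have dmp k x : I x -> is_derive x 1 (fun y => m y k 0 - p y k 0)
    (flow_field r (m x) k 0 - flow_field r (p x) k 0).
  move=> Ix; have ? := (is_derive_colP _ _ _).1 (dm x Ix) k.
  have ? := (is_derive_colP _ _ _).1 (dp x Ix) k.
  exact: is_deriveB.
have e0 k : m 0 k 0 - p 0 k 0 = 0 by rewrite m0 p0 subrr.
have e2 t : I t -> m t 2 0 = p t 2 0.
  move=> It; apply/eqP; rewrite -subr_eq0; apply/eqP.
  apply: (gronwall_eq0 _ _ _ (`|flow_rate r| * 2) t itvI I0 (e0 2) (dmp 2))
    => // x Ix.
  set u := m x 2 0; set v := p x 2 0.
  have u0 := mS _ Ix; have v0 := pS _ Ix; rewrite /Sp1/= in u0 v0.
  rewrite -/u in u0; rewrite -/v in v0.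
  (* On the sphere the coordinate 2 of the field is a (u^3 - u), and u^3 - v^3 has the factor u -
     v. *)
  have -> : flow_field r (m x) 2 0 - flow_field r (p x) 2 0 =
      flow_rate r * (u ^+ 2 + u * v + v ^+ 2 - 1) * (u - v).
    rewrite !flow_fieldE/= -/u -/v.
    rewrite (_ : m x 0 0 ^+ 2 + _ + _ = 1 - u ^+ 2); last by lra.
    by rewrite (_ : p x 0 0 ^+ 2 + _ + _ = 1 - v ^+ 2); [ring|lra].
  rewrite !normrM ler_wpM2r// ler_wpM2l// ler_norml.
  have u1 : u ^+ 2 <= 1.
    by move: (sqr_ge0 (m x 0 0)) (sqr_ge0 (m x 1 0)) (sqr_ge0 (m x 3 0)); lra.
  have v1 : v ^+ 2 <= 1.
    by move: (sqr_ge0 (p x 0 0)) (sqr_ge0 (p x 1 0)) (sqr_ge0 (p x 3 0)); lra.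
  (* The two squares give |u v| <= (u^2 + v^2) / 2 <= 1, so u^2 + u v + v^2 - 1 lies between -1 and
     2; this is the origin of the constant 2. *)
  by move: (sqr_ge0 (u - v)) (sqr_ge0 (u + v)); rewrite sqrrB sqrrD; lra.
move=> t It; apply/colP => k.
have [->|k2] := eqVneq k 2; first exact: e2.
apply/eqP; rewrite -subr_eq0; apply/eqP.
(* As both solutions share their coordinate 2, the fields differ by a p_2^2 (m_k - p_k), and p_2^2
   <= 1. *)
apply: (gronwall_eq0 _ _ _ `|flow_rate r| t itvI I0 (e0 k) (dmp k)) => // x Ix.
rewrite !flow_fieldE (negbTE k2) e2// -mulrBr -mulrA normrM ler_wpM2l//.
rewrite normrM ler_piMl// ger0_norm ?sqr_ge0//.
have := pS _ Ix; rewrite /Sp1/=.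
by move: (sqr_ge0 (p x 0 0)) (sqr_ge0 (p x 1 0)) (sqr_ge0 (p x 3 0)); lra.
Qed.

Lemma explicit_flow_solution r h :
  Sp1 h -> flow_solution_on r setT h (explicit_flow r h).
Proof.
rewrite /Sp1/= => hS; set a := flow_rate r.
pose E (x : R) := expR (a * x).
(* [Q] is the squared norm of (E h_0, E h_1, h_2, E h_3), because 1 - h_2^2 = h_0^2 + h_1^2 +
   h_3^2. *)
pose Q (x : R) := (1 - h 2 0 ^+ 2) * E x ^+ 2 + h 2 0 ^+ 2.
pose u (x : R) := (Num.sqrt (Q x))^-1.
have flowE x k : explicit_flow r h x k 0 =
    if k == 2 then h 2 0 * u x else h k 0 * E x * u x.
  have E1 : 2 * (r ^+ 3 + 2) * (r ^+ 3 - 1) * x / r ^+ 2 = a * x.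
    by rewrite /a /flow_rate mulrAC.
  have E2 : 4 * (r ^+ 3 + 2) * (r ^+ 3 - 1) * x / r ^+ 2 = a * x + a * x.
    by rewrite /a /flow_rate; ring.
  by rewrite mxE E1 E2 expRD -expr2.
have h2 : 1 - h 2 0 ^+ 2 = h 0 0 ^+ 2 + h 1 0 ^+ 2 + h 3 0 ^+ 2.
  by rewrite -hS; ring.
have Q_gt0 x : 0 < Q x.
  have h2_ge0 : 0 <= 1 - h 2 0 ^+ 2 by rewrite h2 !addr_ge0 ?sqr_ge0.
  (* Both summands are nonnegative; the first is positive if h_2 = 0, the second otherwise. *)
  have [h20|h20] := eqVneq (h 2 0) 0.
    by rewrite /Q h20 expr0n subr0 mul1r addr0 exprn_gt0 ?expR_gt0.
  by rewrite ltr_wpDl ?exprn_even_gt0// mulr_ge0 ?sqr_ge0.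
have uQ x : u x ^+ 2 * Q x = 1.
  by rewrite exprVn sqr_sqrtr ?ltW// mulVf ?gt_eqF.
have dE (x : R) : is_derive x 1 E (a * E x) by exact: is_derive_expRM.
have du (x : R) : is_derive x 1 u (- a * (1 - h 2 0 ^+ 2) * E x ^+ 2 * u x ^+ 3).
  have dQ : is_derive x 1 Q (2 * a * (1 - h 2 0 ^+ 2) * E x ^+ 2).
    by apply: is_derive_eq; rewrite /GRing.scale/=; ring.
  have s0 : (Num.sqrt \o Q) x != 0 by rewrite /= gt_eqF// sqrtr_gt0.
  have du := is_deriveV s0 (is_derive1_comp (is_derive1_sqrt (Q_gt0 x)) dQ).
  apply: is_derive_eq.
  rewrite /GRing.scale/= /u; move: s0 => /=; set s := Num.sqrt _ => s0.
  by field.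
split=> //.
  apply/colP => k; rewrite flowE.
  have -> : u 0 = 1.
    by rewrite /u /Q /E mulr0 expR0 expr1n mulr1 subrK sqrtr1 invr1.
  by rewrite /E mulr0 expR0 !mulr1; case: eqP => // ->.
move=> x _; apply/is_derive_colP => k.
rewrite (_ : (fun y => _) = fun y => if k == 2 then h 2 0 * u y
    else h k 0 * E y * u y); last by apply/funext => y; exact: flowE.
rewrite flow_fieldE !flowE/= -/a.
case: (k == 2).
  apply: is_derive_eq; rewrite /GRing.scale/= h2; ring.
apply: is_derive_eq; rewrite /GRing.scale/=.
(* Differentiating [E * u] produces the factor 1 - (1 - h_2^2) E^2 u^2; by u^2 Q = 1 it equals (h_2
   u)^2, the m_2^2 of the field. *)
have s1 : (1 - h 2 0 ^+ 2) * E x ^+ 2 * u x ^+ 2 = 1 - h 2 0 ^+ 2 * u x ^+ 2.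
  by rewrite -[in RHS](uQ x) /Q; ring.
transitivity (h k 0 * E x * a * u x *
    (1 - (1 - h 2 0 ^+ 2) * E x ^+ 2 * u x ^+ 2)); first by ring.
by rewrite s1; ring.
Qed.

End flow.

Theorem proposition3p8 (R : realType) (r : R) (hr : 0 < r)
    (h : 'cV[R]_4) (hSp1 : Sp1 h) :
  flow_solution_on r setT h (explicit_flow r h) /\
  (forall (I : set R) (m : R -> 'cV[R]_4),
      open I -> is_interval I -> flow_solution_on r I h m ->
      forall t : R, I t -> m t = explicit_flow r h t).
Proof.
have sol := explicit_flow_solution r h hSp1; split=> // I m _ itvI solm.
apply: (flow_solution_unique r I h) => //.
(* The global explicit solution restricts to [I], where uniqueness compares it with [m]. *)
by case: solm => I0 _ _; case: sol => _ p0 dp; split=> // x _; exact: dp.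
Qed.
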